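(* Let $\alpha=(\alpha_n)_{n\in\mathbb{N}_0}$ be an increasing sequence with $0<\alpha_n\to\infty$ which is stable. Then the space $\Lambda_0(\alpha)\times\Lambda_\infty(\alpha)$ has a prominent bounded set but does not satisfy $(\overline{\Omega})$.
   Context: Power series spaces: for an increasing sequence $0<\alpha_n\to\infty$, the power series space of finite type is $\Lambda_0(\alpha)=\{x\in\mathbb{C}^{\mathbb{N}_0}: \sum_{n=0}^\infty \exp(-\alpha_n/k)|x_n|<\infty \text{ for all } k\in\mathbb{N}\}$, with $\mathbb{N}=\{1,2,\dots\}$, and the power series space of infinite type is $\Lambda_\infty(\alpha)=\{x\in\mathbb{C}^{\mathbb{N}_0}: \sum_{n=0}^\infty \exp(k\alpha_n)|x_n|<\infty \text{ for all } k\in\mathbb{N}_0\}$; both are Fréchet spaces with the seminorms given by these sums, and the product carries the product topology. The sequence $\alpha$ is called stable if $\alpha_{2n}/\alpha_n$ is bounded. Prominent sets: let $X$ be a locally convex space and $\mathscr{U}_0(X)$ the system of its absolutely convex $0$-neighbourhoods. For $n\in\mathbb{N}_0$, $V\subseteq X$ and an absolutely convex set $U\subseteq X$, the $n$-th Kolmogorov width is $\delta_n(V,U)=\inf\{\delta>0: V\subseteq \delta U+L$ for an at most $n$-dimensional linear subspace $L$ of $X\}$ (with $\inf\emptyset=+\infty$). The diametral dimension of $X$ is $\Delta(X)=\{(\xi_n)_{n\in\mathbb{N}_0}\in\mathbb{R}^{\mathbb{N}_0}: \forall U\in\mathscr{U}_0(X)\ \exists V\in\mathscr{U}_0(X) \text{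 with } \xi_n\delta_n(V,U)\to 0\}$. A bounded subset $B$ of $X$ is called prominent if $\Delta(X)=\{\xi\in\mathbb{R}^{\mathbb{N}_0}: \xi_n\delta_n(B,U)\to 0 \text{ for all } U\in\mathscr{U}_0(X)\}$. Condition $(\overline{\Omega})$: a Fréchet space $X$ with an increasing fundamental sequence of seminorms $(\|\cdot\|_k)_k$ and corresponding dual norms $\|\varphi\|_k^*=\sup\{|\varphi(x)|:\|x\|_k\le 1\}\in[0,\infty]$ for $\varphi\in X'$ (the topological dual) satisfies $(\overline{\Omega})$ if for every $k$ there is $\ell\ge k$ such that for every $m\ge\ell$ there is $C>0$ with $(\|\varphi\|_\ell^* )^2\le C\,\|\varphi\|_k^*\,\|\varphi\|_m^*$ for all $\varphi\in X'$. *)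

(* Defs.v *)
From HB Require Import structures.
From mathcomp Require Import all_boot all_order all_algebra.
From mathcomp Require Import all_classical all_reals all_analysis.
From mathcomp Require Export complex.
Set Implicit Arguments.
Unset Strict Implicit.
Unset Printing Implicit Defensive.
Import Order.TTheory GRing.Theory Num.Theory.
Import numFieldTopology.Exports numFieldNormedType.Exports.
Local Open Scope classical_set_scope.
Local Open Scope ring_scope.
Local Open Scope complex_scope.

(* The modulus of a complex number as a real number: the library norm on R[i]
   takes its values in R[i], and `|z| = (normc z)%:C. *)
Notation normc := ComplexField.Normc.normc.

Definition seminorm (R : realType) (X : lmodType R[i]) (q : X -> R) :=
  (forall x y, q (x + y) <= q x + q y) /\
  (forall (a : R[i]) x, q (a *: x) = normc a * q x).

Section LocallyConvex.
Context {R : realType} {X : tvsType R[i]}.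
Implicit Types (U V B L : set X) (p : nat -> X -> R).

Definition absolutely_convex U := U !=set0 /\
  forall (a b : R[i]) (x y : X), U x -> U y ->
    normc a + normc b <= 1 -> U (a *: x + b *: y).

Definition zero_nbhds : set (set X) :=
  [set U | nbhs (0 : X) U /\ absolutely_convex U].

Definition dim_le (n : nat) L := exists b : 'I_n -> X,
  L = [set x | exists a : 'I_n -> R[i], x = \sum_(i < n) a i *: b i].

Definition kolmogorov_width (n : nat) V U : \bar R :=
  ereal_inf [set d%:E | d in [set d : R | 0 < d /\
    exists2 L, dim_le n L &
      V `<=` [set d%:C *: u + l | u in U & l in L]]].

(* The products below use the convention 0 * +oo = 0.  It plays no role:
   widths of bounded sets are finite, and so are those of V when V is
   replaced by the smaller neighbourhood V `&` U. *)
Definition width_cvg0 (xi : nat -> R) V U :=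
  ((xi n)%:E * kolmogorov_width n V U)%E @[n --> \oo] --> 0%E.

Definition diametral_dimension : set (nat -> R) :=
  [set xi | forall U, zero_nbhds U ->
    exists2 V, zero_nbhds V & width_cvg0 xi V U].

Definition tvs_bounded B := forall U, zero_nbhds U ->
  exists2 r : R, 0 < r & B `<=` [set r%:C *: u | u in U].

Definition prominent B := tvs_bounded B /\
  diametral_dimension =
    [set xi | forall U, zero_nbhds U -> width_cvg0 xi B U].

Definition fundamental_seminorms p :=
  [/\ forall k, seminorm (p k),
      forall k x, p k x <= p k.+1 x &
      forall U, nbhs (0 : X) U <->
        exists k, exists2 e : R, 0 < e & [set x | p k x < e] `<=` U].

Definition dual_norm (q : X -> R) (phi : X -> R[i]) : \bar R :=
  ereal_sup [set (normc (phi x))%:E | x in [set x | q x <= 1]].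

(* No indeterminate product 0 * +oo occurs on the right-hand side: if one of
   the dual norms of phi vanishes then phi = 0. *)
Definition Omega_bar_for p :=
  forall k, exists2 l, (k <= l)%N & forall m, (l <= m)%N ->
    exists2 C : R, 0 < C &
      forall phi : {linear X -> R[i]^o}, continuous phi ->
        (dual_norm (p l) phi ^+ 2 <=
           C%:E * dual_norm (p k) phi * dual_norm (p m) phi)%E.

End LocallyConvex.

Arguments diametral_dimension {R} X.

(* The choice of the fundamental sequence is immaterial: the constants k, l, m
   can be adjusted between any two of them. *)
Definition Omega_bar (R : realType) (X : tvsType R[i]) :=
  exists2 p : nat -> X -> R, fundamental_seminorms p & Omega_bar_for p.

(* Sequences that are absolutely summable with respect to each of the weights
   n |-> exp (c k n), k : nat, topologized by the weighted l^1 seminorms *)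
Section WeightedSequences.
Context {R : realType}.
Variable c : nat -> nat -> R.

Definition weighted_sum (k : nat) (x : nat -> R[i]) : \bar R :=
  (\sum_(0 <= n <oo) (expR (c k n) * normc (x n))%:E)%E.

Definition weighted_summable : {pred nat -> R[i]^o} :=
  fun x => `[< forall k, (weighted_sum k x < +oo)%E >].

Lemma normc_ge0 (z : R[i]) : 0 <= normc z.
Proof. by case: z => a b; exact: sqrtr_ge0. Qed.

Lemma weighted_term_ge0 k (x : nat -> R[i]) n :
  (0 <= (expR (c k n) * normc (x n))%:E)%E.
Proof. by rewrite lee_fin mulr_ge0 ?expR_ge0 ?normc_ge0. Qed.

Lemma weighted_sum_ge0 k x : (0 <= weighted_sum k x)%E.
Proof. by apply: nneseries_ge0 => n _ _; exact: weighted_term_ge0. Qed.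

Lemma weighted_sumZ k (a : R[i]) (x : nat -> R[i]^o) :
  weighted_sum k (a *: x) = ((normc a)%:E * weighted_sum k x)%E.
Proof.
rewrite /weighted_sum -nneseriesZl; last by move=> *; exact: weighted_term_ge0.
apply: eq_eseriesr => n _; rewrite -EFinM; congr (_%:E).
by rewrite [(a *: x) n]/(a * x n) ComplexField.Normc.normcM mulrCA.
Qed.

Lemma weighted_sumD k (x y : nat -> R[i]^o) :
  (weighted_sum k (x + y)%R <= weighted_sum k x + weighted_sum k y)%E.
Proof.
rewrite /weighted_sum -nneseriesD; [|by move=> *; exact: weighted_term_ge0..].
apply: lee_nneseries => n *; first exact: weighted_term_ge0.
rewrite -EFinD lee_fin -mulrDr ler_pM2l ?expR_gt0//.
exact: le_normcD.
Qed.

Lemma weighted_summable_closed : submod_closed weighted_summable.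
Proof.
split=> [|a x y /asboolP x_fin /asboolP y_fin]; apply/asboolP => k.
  rewrite /weighted_sum eseries0 ?ltry// => n _ _.
  by rewrite [(0 : nat -> R[i]^o) n]/(0 : R[i]) ComplexField.Normc.normc0 mulr0.
apply: (le_lt_trans (weighted_sumD k _ _)).
rewrite lte_add_pinfty// weighted_sumZ lte_mul_pinfty ?lee_fin ?normc_ge0//.
Qed.

HB.instance Definition _ :=
  GRing.isSubmodClosed.Build R[i] (nat -> R[i]^o) weighted_summable
    weighted_summable_closed.

Definition weighted_l1 := {x : nat -> R[i]^o | x \in weighted_summable}.

HB.instance Definition _ := SubChoice.on weighted_l1.
HB.instance Definition _ := [SubChoice_isSubLmodule of weighted_l1 by <:].

Definition weighted_seminorm (k : nat) (x : weighted_l1) : R :=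
  fine (weighted_sum k (val x)).
Local Notation q := weighted_seminorm.

Lemma weighted_sum_fin k (x : weighted_l1) :
  weighted_sum k (val x) \is a fin_num.
Proof.
by rewrite ge0_fin_numE ?weighted_sum_ge0//; exact: (asboolP _ (valP x)).
Qed.

Lemma weighted_seminormP k : seminorm (q k).
Proof.
split=> [x y|a x]; rewrite /q.
  rewrite -fineD ?weighted_sum_fin// fine_le ?fin_numD ?weighted_sum_fin//.
  exact: weighted_sumD.
by rewrite weighted_sumZ fineM ?weighted_sum_fin.
Qed.

Definition weighted_ball (x : weighted_l1) (k : nat) (e : R) : set weighted_l1 :=
  [set y | forall j, (j <= k)%N -> q j (y - x) < e].

Definition weighted_open : set (set weighted_l1) :=
  [set U | forall x, U x ->
    exists k, exists2 e : R, 0 < e & weighted_ball x k e `<=` U].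

Lemma weighted_openT : weighted_open setT.
Proof. by move=> x _; exists 0%N, 1. Qed.

Lemma weighted_openI : setI_closed weighted_open.
Proof.
move=> U V Uo Vo x [/Uo[k [e e0 kU]] /Vo[l [d d0 lV]]].
exists (maxn k l), (Num.min e d); first by rewrite lt_min e0.
move=> y xy; split; [apply: kU|apply: lV] => j jk.
  by have := xy j; rewrite leq_max jk lt_min => /(_ isT)/andP[].
by have := xy j; rewrite leq_max jk orbT lt_min => /(_ isT)/andP[].
Qed.

Lemma weighted_open_bigU (I : Type) (f : I -> set weighted_l1) :
  (forall i, weighted_open (f i)) -> weighted_open (\bigcup_i f i).
Proof.
move=> fo x [i _ /fo[k [e e0 xf]]]; exists k, e => // y /xf fy.
by exists i.
Qed.

HB.instance Definition _ := isOpenTopological.Build weighted_l1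
  weighted_openT weighted_openI weighted_open_bigU.

Lemma weighted_seminorm0 k : q k 0 = 0.
Proof.
have [_ /(_ 0 0)] := weighted_seminormP k.
by rewrite scale0r ComplexField.Normc.normc0 mul0r.
Qed.

Lemma weighted_seminorm_ge0 k x : 0 <= q k x.
Proof. exact/fine_ge0/weighted_sum_ge0. Qed.

Lemma weighted_ball_center x k e : 0 < e -> weighted_ball x k e x.
Proof. by move=> e0 j _; rewrite subrr weighted_seminorm0. Qed.

Lemma weighted_ball_open x k e : open (weighted_ball x k e).
Proof.
suff : weighted_open (weighted_ball x k e) by [].
move=> y xy; pose d := \big[Num.min/1]_(j < k.+1) (e - q j (y - x)).
exists k, d.
  rewrite /d; elim/big_ind : _ => //.
    by move=> u v u0 v0; rewrite lt_min u0 v0.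
  by move=> j _; rewrite subr_gt0 xy// -ltnS.
move=> z yz j jk; have jk' : (j < k.+1)%N by [].
have [qD _] := weighted_seminormP j.
rewrite -(subrK y z) -addrA (le_lt_trans (qD _ _))// -ltrBrDr.
apply: (lt_le_trans (yz j jk)).
exact: (bigmin_le_cond _ (j := Ordinal jk')).
Qed.

Lemma weighted_nbhsE (x : weighted_l1) (A : set weighted_l1) :
  nbhs x A <-> exists k, exists2 e : R, 0 < e & weighted_ball x k e `<=` A.
Proof.
split=> [[U [Uo Ux UA]]|[k [e e0 xA]]].
  have [k [e e0 xU]] := Uo x Ux.
  by exists k, e => //; exact: subset_trans xU UA.
apply: filterS xA _; apply: open_nbhs_nbhs; split.
  exact: weighted_ball_open.
exact: weighted_ball_center.
Qed.

Lemma weighted_add_continuous :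
  continuous (fun x : weighted_l1 * weighted_l1 => x.1 + x.2).
Proof.
move=> [x y] A /= /weighted_nbhsE[k [e e0 xyA]].
have e20 : 0 < e / 2 by rewrite divr_gt0.
exists (weighted_ball x k (e / 2), weighted_ball y k (e / 2)).
  by split; apply/weighted_nbhsE; exists k, (e / 2).
move=> [u v] /= [xu yv]; apply: xyA => j jk.
have [qD _] := weighted_seminormP j.
rewrite opprD addrACA (le_lt_trans (qD _ _))// (splitr e) ltrD//.
  exact: xu.
exact: yv.
Qed.

Lemma normc_real (a : R[i]) : `|a| = (normc a)%:C.
Proof. by []. Qed.

Lemma weighted_scale_continuous :
  continuous (fun z : R[i]^o * weighted_l1 => z.1 *: z.2).
Proof.
move=> [a x] A /= /weighted_nbhsE[k [e e0 axA]].
pose M := 1 + \sum_(j < k.+1) q j x.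
have M1 : 1 <= M by rewrite lerDl sumr_ge0// => j _; exact: weighted_seminorm_ge0.
have qM j : (j <= k)%N -> q j x <= M.
  move=> jk; have jk' : (j < k.+1)%N by [].
  rewrite /M (bigD1 (Ordinal jk'))//= addrCA lerDl addr_ge0//.
  by rewrite sumr_ge0// => i _; exact: weighted_seminorm_ge0.
have M0 : 0 < M by exact: lt_le_trans M1.
pose N := normc a + 1; have N0 : 0 < N by rewrite ltr_wpDl// normc_ge0.
pose d := Num.min 1 (e / 2 / M).
have d0 : 0 < d by rewrite lt_min ltr01 !divr_gt0.
have f0 : 0 < e / 2 / N by rewrite !divr_gt0.
exists (ball (a : R[i]^o) d%:C, weighted_ball x k (e / 2 / N)).
  split; last by apply/weighted_nbhsE; exists k, (e / 2 / N).
  by apply: nbhsx_ballx; rewrite ltcR.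
move=> [b y] /= [ab xy]; apply: axA => j jk.
have [qD qZ] := weighted_seminormP j.
have {}ab : normc (b - a) < d.
  have : `|a - b| < d%:C by exact: ab.
  by rewrite distrC normc_real ltcR.
have bN : normc b <= N.
  rewrite -(subrK a b) (le_trans (le_normcD _ _))// addrC lerD2l.
  by rewrite ltW// (lt_le_trans ab)// ge_min lexx.
have -> : b *: y - a *: x = b *: (y - x) + (b - a) *: x.
  by rewrite scalerBr scalerBl addrA subrK.
rewrite (le_lt_trans (qD _ _))// !qZ (splitr e) ltr_leD//.
  rewrite (le_lt_trans (ler_wpM2r (weighted_seminorm_ge0 _ _) bN))//.
  by rewrite mulrC -ltr_pdivlMr//; exact: xy.
rewrite -(divfK (lt0r_neq0 M0) (e / 2)).
apply: ler_pM; rewrite ?normc_ge0 ?weighted_seminorm_ge0 ?qM//.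
by rewrite ltW// (lt_le_trans ab)// ge_min lexx orbT.
Qed.

Lemma weighted_locally_convex : exists2 B : set (set weighted_l1),
  (forall b, b \in B -> convex_set b) & basis B.
Proof.
exists [set b | exists x k e, b = weighted_ball x k e].
  move=> b; rewrite inE => -[x [k [e ->]]].
  move=> y z t /set_mem xy /set_mem xz; apply/mem_set => j jk.
  have [qD qZ] := weighted_seminormP j.
  pose u : R[i] := t%:num; pose v : R[i] := 1 - u.
  have uv : normc u + normc v = 1.
    have u0 : 0 <= u by rewrite /u.
    have v0 : 0 <= v by rewrite subr_ge0 /u.
    suff : (normc u + normc v)%:C = (1 : R)%:C.
      by move=> /(congr1 (@complex.Re R)).
    by rewrite rmorphD rmorph1 /= -!normc_real !ger0_norm// addrC subrK.
  change (q j ((u *: y + v *: z) - x) < e).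
  rewrite (_ : u *: y + v *: z - x = u *: (y - x) + v *: (z - x)); last first.
    rewrite !scalerBr addrACA -opprD -scalerDl [u + v]addrC.
    by rewrite /v subrK scale1r.
  have lt_comb (r s : R) : r < e -> s < e -> normc u * r + normc v * s < e.
    move=> re se; pose m := Num.max r s.
    have me : m < e by rewrite gt_max re se.
    apply: le_lt_trans me; rewrite -[leRHS]mul1r -uv mulrDl.
    by rewrite lerD// ler_wpM2l ?normc_ge0// le_max lexx ?orbT.
  by rewrite (le_lt_trans (qD _ _))// !qZ; apply: lt_comb; [exact: xy|exact: xz].
split; first by move=> b [x [k [e ->]]]; exact: weighted_ball_open.
move=> x A /weighted_nbhsE[k [e e0 xA]]; exists (weighted_ball x k e) => //.
by split; [exists x, k, e|exact: weighted_ball_center].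
Qed.

(* This factory only provides the uniform structure. *)
HB.instance Definition _ := PreTopologicalLmod_isTvs.Build R[i] weighted_l1
  weighted_add_continuous weighted_scale_continuous weighted_locally_convex.
HB.instance Definition _ := PreTopologicalNmodule_isTopologicalNmodule.Build
  weighted_l1 weighted_add_continuous.
HB.instance Definition _ := TopologicalNmodule_isTopologicalLmodule.Build
  R[i] weighted_l1 weighted_scale_continuous.
HB.instance Definition _ := Uniform_isTvs.Build R[i] weighted_l1
  weighted_locally_convex.

End WeightedSequences.

Section PowerSeriesSpaces.
Context {R : realType}.
Variable alpha : nat -> R.

(* The weight of index k here is the one of index k + 1 in {1, 2, ...}. *)
Definition Lambda0 : tvsType R[i] :=
  weighted_l1 (fun k n => - alpha n / k.+1%:R).
Definition Lambda_infty : tvsType R[i] :=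
  weighted_l1 (fun k n => k%:R * alpha n).

Definition stable := bounded_fun (fun n => alpha n.*2 / alpha n).

(* The sums defining Lambda0 and Lambda_infty give a fundamental sequence of
   seminorms of the product, so that Omega_bar is not vacuously false. *)
Definition Lambda_prod_seminorm (k : nat) (z : Lambda0 * Lambda_infty) : R :=
  weighted_seminorm k z.1 + weighted_seminorm k z.2.
End PowerSeriesSpaces.

Lemma weighted_seminorm_le (R : realType) (c : nat -> nat -> R) k l
    (x : weighted_l1 c) : (forall n, c k n <= c l n) ->
  weighted_seminorm k x <= weighted_seminorm l x.
Proof.
move=> ckl; rewrite fine_le ?weighted_sum_fin// lee_nneseries// => n *.
  exact: weighted_term_ge0.
by rewrite lee_fin ler_wpM2r ?normc_ge0// ler_expR.
Qed.

Lemma Lambda_prod_fundamental (R : realType) (alpha : nat -> R) :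
  (forall n, 0 < alpha n) -> fundamental_seminorms (@Lambda_prod_seminorm R alpha).
Proof.
move=> a0.
have q0 k l (x : Lambda0 alpha) : (k <= l)%N ->
    weighted_seminorm k x <= weighted_seminorm l x.
  move=> kl; apply: weighted_seminorm_le => n.
  rewrite !mulNr lerN2 ler_wpM2l ?(ltW (a0 n))// lef_pV2 ?posrE//.
  by rewrite ler_nat ltnS.
have q1 k l (x : Lambda_infty alpha) : (k <= l)%N ->
    weighted_seminorm k x <= weighted_seminorm l x.
  move=> kl; apply: weighted_seminorm_le => n.
  by rewrite ler_wpM2r ?(ltW (a0 n))// ler_nat.
split=> [k|k [x y]|U].
- split=> [[x y] [u v]|a [x y]]; rewrite /Lambda_prod_seminorm /=.
    by rewrite addrACA lerD//; apply: (weighted_seminormP _ _).1.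
  by rewrite mulrDr !(weighted_seminormP _ _).2.
- exact: lerD (q0 k k.+1 x (leqnSn k)) (q1 k k.+1 y (leqnSn k)).
split=> [[[A B] [/= /weighted_nbhsE[k [e e0 kA]] /weighted_nbhsE[l [d d0 lB]]] AB]|].
  exists (maxn k l), (Num.min e d); first by rewrite lt_min e0.
  move=> [x y]; rewrite /= /Lambda_prod_seminorm lt_min /= => /andP[xe yd].
  apply: AB; split=> /=.
    apply: kA => j jk; rewrite subr0; apply: le_lt_trans xe.
    have jm : (j <= maxn k l)%N by rewrite leq_max jk.
    apply: le_trans (q0 j (maxn k l) x jm) _.
    by rewrite lerDl weighted_seminorm_ge0.
  apply: lB => j jl; rewrite subr0; apply: le_lt_trans yd.
  have jm : (j <= maxn k l)%N by rewrite leq_max jl orbT.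
  apply: le_trans (q1 j (maxn k l) y jm) _.
  by rewrite lerDr weighted_seminorm_ge0.
move=> [k [e e0 kU]].
have e20 : 0 < e / 2 by rewrite divr_gt0.
exists (weighted_ball 0 k (e / 2), weighted_ball 0 k (e / 2)).
  by split; apply/weighted_nbhsE; exists k, (e / 2).
move=> [x y] /= [xe ye]; apply: kU; rewrite /= /Lambda_prod_seminorm /=.
rewrite (splitr e) ltrD//.
  by have := xe k (leqnn k); rewrite subr0.
by have := ye k (leqnn k); rewrite subr0.
Qed.

(* Main.v *)
(* The diametral dimension of the product is that of [Lambda0]: it consists of
   the [xi] with [xi_n * exp (- alpha_n / k) --> 0] for all [k].  Stability is
   what keeps the factor [Lambda_infty] invisible: approximating by the first
   [n / 2] unit vectors of each factor gives widths [O (exp (- t * alpha_n))]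
   for some [t > 0].  The unit vectors of [Lambda0] form a bounded set with
   widths at least [exp (- alpha_n / k)], hence a prominent one.
   For (Omega bar), the [n]-th coordinate functional of [Lambda_infty] has dual
   norm [exp (- k * alpha_n)] for the [k]-th seminorm; since [alpha_n] tends to
   infinity, the inequality fails as soon as [m > 2 * l - k]. *)
From HB Require Import structures.
Require Import Defs.
From mathcomp Require Import all_boot all_order all_algebra.
From mathcomp Require Import all_classical all_reals all_analysis.
From mathcomp Require Import ring.
Set Implicit Arguments.
Unset Strict Implicit.
Unset Printing Implicit Defensive.
Import Order.TTheory GRing.Theory Num.Theory.
Import numFieldTopology.Exports numFieldNormedType.Exports.
Local Open Scope classical_set_scope.
Local Open Scope ring_scope.

Lemma normc_real_ge0 (R : realType) (r : R) : 0 <= r -> normc (r%:C)%C = r.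
Proof. by move=> r0; rewrite /= expr0n addr0 sqrtr_sqr ger0_norm. Qed.

(** Each transfer of [xi n * delta_n --> 0] from one pair of sets to another is an instance of this
    comparison; absolute values allow [xi] of any sign. *)
Lemma mule_cvg0_dominated (R : realType) (xi : nat -> R) (w1 w2 : nat -> \bar R)
    (r : R) : 0 <= r ->
  (\forall n \near \oo, (0 <= w1 n <= r%:E * w2 n)%E) ->
  ((xi n)%:E * w2 n)%E @[n --> \oo] --> 0%E ->
  ((xi n)%:E * w1 n)%E @[n --> \oo] --> 0%E.
Proof.
move=> r0 w12 /cvg_abse; rewrite abse0 => cvg2; apply/cvg_abse0P.
have cvgr : (r%:E * `|(xi n)%:E * w2 n|)%E @[n --> \oo] --> 0%E.
  by have := cvgeZl (isT : r%:E \is a fin_num) cvg2; rewrite mule0.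
apply: (squeeze_cvge _ _ cvgr); last exact: cvg_cst.
near=> n; rewrite /= abse_ge0 !abseM muleCA lee_wpmul2l//.
have /andP[w1_ge0 w12n] : (0 <= w1 n <= r%:E * w2 n)%E by near: n.
rewrite gee0_abs// (le_trans w12n)//.
have w2_ge0 : (r%:E * w2 n <= `|r%:E * w2 n|)%E by exact: lee_abs.
by rewrite (le_trans w2_ge0)// abseM gee0_abs.
Unshelve. all: by end_near. Qed.

(** * Seminorms and their balls *)

Section Seminorms.
Context {R : realType} {X : tvsType R[i]} {q : X -> R}.
Hypothesis q_seminorm : seminorm q.

Lemma seminorm0 : q 0 = 0.
Proof.
by rewrite -(scale0r (0 : X)) q_seminorm.2 ComplexField.Normc.normc0 mul0r.
Qed.

Lemma seminormZ_real (r : R) x : 0 <= r -> q (r%:C%C *: x) = r * q x.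
Proof. by move=> r0; rewrite q_seminorm.2 normc_real_ge0. Qed.

Lemma seminorm_ball_absolutely_convex (e : R) :
  0 < e -> absolutely_convex [set x | q x < e].
Proof.
move=> e0; split=> [|a b x y /= xe ye ab].
  by exists 0; rewrite /= seminorm0.
apply: le_lt_trans (q_seminorm.1 _ _) _.
rewrite !q_seminorm.2; pose m := Num.max (q x) (q y).
have m_lt : m < e by rewrite gt_max xe ye.
have le_m : normc a * q x + normc b * q y <= (normc a + normc b) * m.
  by rewrite mulrDl lerD// ler_wpM2l ?normc_ge0// le_max lexx ?orbT.
apply: le_lt_trans le_m _.
(* The definition of [seminorm] does not include nonnegativity, so a negative maximum [m] is treated
   separately. *)
have [m_ge0|m_lt0] := leP 0 m.
  by rewrite (le_lt_trans _ m_lt)// ler_piMl.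
by rewrite (le_lt_trans _ e0)// mulr_ge0_le0 ?addr_ge0 ?normc_ge0 ?ltW.
Qed.

End Seminorms.

(** * Widths, bounded sets and dual norms in a general space *)

Section Widths.
Context {R : realType} {X : tvsType R[i]}.
Implicit Types (U V B : set X) (p : nat -> X -> R).

Lemma kolmogorov_width_ge0 n V U : (0 <= kolmogorov_width n V U)%E.
Proof. by apply: le_ereal_inf_tmp => _ [d [d0 _] <-]; rewrite lee_fin ltW. Qed.

Lemma kolmogorov_width_le n V U (b : 'I_n -> X) (d : R) : 0 < d ->
  (forall x, V x -> exists a : 'I_n -> R[i],
     U ((d^-1)%:C%C *: (x - \sum_(i < n) a i *: b i))) ->
  (kolmogorov_width n V U <= d%:E)%E.
Proof.
move=> d0 VU; apply: ereal_inf_lbound; exists d => //; split=> //.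
exists [set x | exists a : 'I_n -> R[i], x = \sum_(i < n) a i *: b i].
  by exists b.
move=> x /VU[a Ua]; exists ((d^-1)%:C%C *: (x - \sum_(i < n) a i *: b i)) => //.
exists (\sum_(i < n) a i *: b i); first by exists a.
rewrite scalerA -rmorphM /= divff ?gt_eqF//.
by rewrite rmorph1 scale1r subrK.
Qed.

(** If [V] lies in d U + L, then r V lies in r d U + L, because the linear subspace L absorbs the
    factor [r]. *)
Lemma kolmogorov_width_bounded n B V U (r : R) : 0 < r ->
    B `<=` [set r%:C%C *: v | v in V] ->
  (kolmogorov_width n B U <= r%:E * kolmogorov_width n V U)%E.
Proof.
move=> r0 BV; rewrite -lee_pdivrMl//; apply: le_ereal_inf_tmp.
move=> _ [d [d0 [L [b ->] VU]] <-].
rewrite lee_pdivrMl// -EFinM; apply: ereal_inf_lbound.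
exists (r * d) => //; split; first exact: mulr_gt0.
exists [set x | exists a : 'I_n -> R[i], x = \sum_(i < n) a i *: b i].
  by exists b.
move=> _ /BV[v /VU[u Uu [l [a ->] <-]] <-].
exists u => //; exists (\sum_(i < n) (r%:C%C * a i) *: b i); first by eexists.
rewrite scalerDr scalerA rmorphM scaler_sumr; congr (_ + _).
by apply: eq_bigr => i _; rewrite scalerA.
Qed.

(** This half of prominence holds for every bounded set: [B] is absorbed by the neighbourhood [V],
    so its widths are at most a multiple of those of [V]. *)
Lemma diametral_dimension_bounded (xi : nat -> R) B U :
    tvs_bounded B -> diametral_dimension X xi -> zero_nbhds U ->
  width_cvg0 xi B U.
Proof.
move=> Bb xiX /xiX[V V0 xiV]; have [r r0 BV] := Bb V V0.
apply: (mule_cvg0_dominated (ltW r0) _ xiV); apply: nearW => n.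
by rewrite kolmogorov_width_ge0 kolmogorov_width_bounded.
Qed.

Lemma fundamental_zero_nbhds p k (e : R) : fundamental_seminorms p ->
  0 < e -> zero_nbhds [set x | p k x < e].
Proof.
move=> [pP _ nP] e0; split; first by apply/nP; exists k, e.
exact: seminorm_ball_absolutely_convex.
Qed.

Lemma fundamental_tvs_bounded p B (M : nat -> R) : fundamental_seminorms p ->
  (forall k x, B x -> p k x <= M k) -> tvs_bounded B.
Proof.
move=> [pP _ nP] BM U [/nP[k [e e0 kU]] _].
(* This makes [r * e] exceed [M k], so that [r^-1 *: x] lands in the [e]-ball of [p k]. *)
pose r := (`|M k| + 1) / e; have r0 : 0 < r by rewrite divr_gt0// ltr_wpDl.
exists r => // x Bx; exists ((r^-1)%:C%C *: x); last first.
  by rewrite scalerA -rmorphM divff ?gt_eqF// rmorph1 scale1r.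
apply: kU; rewrite /= (seminormZ_real (pP k)) ?invr_ge0 ?ltW//.
rewrite mulrC ltr_pdivrMr// /r mulrCA divff ?gt_eqF// mulr1.
by rewrite (le_lt_trans (BM k x Bx))// (le_lt_trans (ler_norm _))// ltrDl.
Qed.

(** Both sequences generate the same neighbourhoods of 0, so the unit ball of [p k] contains a ball
    of some [p' l]; homogeneity gives the bound. It carries estimates for the explicit seminorms
    over to the arbitrary sequence in [Omega_bar]. *)
Lemma fundamental_compare p p' k : fundamental_seminorms p ->
    fundamental_seminorms p' ->
  exists l, exists2 C : R, 0 < C & forall x, p' l x <= 1 -> p k x <= C.
Proof.
move=> [pP _ nP] [pP' _ nP'].
have /nP'[l [e e0 lk]] : nbhs (0 : X) [set x | p k x < 1].
  by apply/nP; exists k, 1.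
exists l, (2 / e); first by rewrite divr_gt0.
move=> x x1; have e20 : 0 < e / 2 by rewrite divr_gt0.
(* The factor [e / 2] turns [p' l x <= 1] into the strict bound that [lk] requires. *)
have : p k ((e / 2)%:C%C *: x) < 1.
  apply: lk; rewrite /= (seminormZ_real (pP' l)) ?ltW//.
  rewrite (le_lt_trans (ler_piMr (ltW e20) x1))// ltr_pdivrMr// ltr_pMr//.
  by rewrite ltr1n.
rewrite (seminormZ_real (pP k)) ?(ltW e20)// => /ltW.
by rewrite -ler_pdivlMl// invf_div mulr1.
Qed.

Lemma fundamental_le p k l x : fundamental_seminorms p ->
  (k <= l)%N -> p k x <= p l x.
Proof.
move=> [_ pi _] /subnK<-; elim: (l - k)%N => // j; move/le_trans; exact.
Qed.

Lemma dual_norm_le (q : X -> R) (phi : X -> R[i]) (M : R) :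
  (forall x, q x <= 1 -> normc (phi x) <= M) -> (dual_norm q phi <= M%:E)%E.
Proof.
by move=> qM; apply: ge_ereal_sup => _ [x /qM xM <-]; rewrite lee_fin.
Qed.

Lemma dual_norm_ge (q : X -> R) (phi : X -> R[i]) x :
  q x <= 1 -> ((normc (phi x))%:E <= dual_norm q phi)%E.
Proof. by move=> x1; apply: ereal_sup_ubound; exists x. Qed.

End Widths.

(** * Unit vectors, coordinates and tails in weighted spaces *)

Section WeightedSpace.
Context {R : realType} (c : nat -> nat -> R).
Implicit Types (x y : weighted_l1 c) (k m n : nat).

Lemma weighted_sum_unit k n :
  weighted_sum c k (fun j => (j == n)%:R) = (expR (c k n))%:E.
Proof.
rewrite /weighted_sum (@nneseriesD1 _ _ n)//; last first.
  by move=> j _; exact: (weighted_term_ge0 c k (fun j => (j == n)%:R)).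
rewrite eseries0; last first.
  by move=> j _ /= /negbTE->; rewrite ComplexField.Normc.normc0 mulr0.
by rewrite eqxx ComplexField.Normc.normc1 mulr1 adde0.
Qed.

Lemma unit_seq_summable n :
  (fun j => (j == n)%:R : R[i]^o) \in weighted_summable c.
Proof. by apply/asboolP => k; rewrite weighted_sum_unit ltry. Qed.

Definition unit_seq n : weighted_l1 c := 
  exist (fun x : nat -> R[i]^o => x \in weighted_summable c) _
    (unit_seq_summable n).

Lemma weighted_seminorm_unit_seq k n :
  weighted_seminorm k (unit_seq n) = expR (c k n).
Proof. by rewrite /weighted_seminorm weighted_sum_unit. Qed.

Definition coordinate n x : R[i]^o := val x n.

Lemma coordinate_is_linear n : linear (coordinate n).
Proof. by []. Qed.

HB.instance Definition _ n := GRing.isLinear.Build R[i] (weighted_l1 c) R[i]^o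
  *:%R (coordinate n) (coordinate_is_linear n).

Lemma coordinate_unit_seq n j : coordinate n (unit_seq j) = (n == j)%:R.
Proof. by []. Qed.

Lemma weighted_partial_sum_le k n x :
  \sum_(j < n) expR (c k j) * normc (coordinate j x) <= weighted_seminorm k x.
Proof.
rewrite -lee_fin fineK ?weighted_sum_fin// -sumEFin.
rewrite -(big_mkord xpredT
  (fun j => (expR (c k j) * normc (coordinate j x))%:E)).
by apply: nneseries_lim_ge => j _ _; exact: weighted_term_ge0.
Qed.

Lemma normc_coordinate_le k n x :
  expR (c k n) * normc (coordinate n x) <= weighted_seminorm k x.
Proof.
apply: le_trans _ (weighted_partial_sum_le k n.+1 x).
rewrite big_ord_recr/= lerDr sumr_ge0// => j _.
by rewrite mulr_ge0 ?expR_ge0 ?normc_ge0.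
Qed.

Definition head n x := \sum_(j < n) coordinate j x *: unit_seq j.

Lemma coordinate_head n x j :
  coordinate j (head n x) = (j < n)%:R * coordinate j x.
Proof.
rewrite /head linear_sum /=.
under eq_bigr do rewrite linearZ /= coordinate_unit_seq.
have [jn|nj] := ltnP j n; last first.
  rewrite mul0r big1// => i _; rewrite gtn_eqF ?scaler0//.
  exact: leq_trans (ltn_ord i) nj.
rewrite (bigD1 (Ordinal jn))//= eqxx big1 ?addr0 ?mul1r; last first.
  by move=> i; rewrite -val_eqE /= eq_sym => /negbTE->; rewrite scaler0.
exact: mulr1.
Qed.

(** The entries before [n] cancel, and from [n] on each weight of level [k] is at most exp (- t)
    times that of level [m]. *)
Lemma weighted_seminorm_tail k m n (t : R) x :
  (forall j, (n <= j)%N -> c k j <= c m j - t) ->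
  weighted_seminorm k (x - head n x) <= expR (- t) * weighted_seminorm m x.
Proof.
move=> ckm; rewrite -lee_fin EFinM !fineK ?weighted_sum_fin//.
rewrite /weighted_sum -nneseriesZl; last by move=> *; exact: weighted_term_ge0.
apply: lee_nneseries => [j *|j _]; first exact: weighted_term_ge0.
have -> : val (x - head n x) j = coordinate j (x - head n x) by [].
rewrite linearB /= coordinate_head -EFinM lee_fin.
have [jn|nj] := ltnP j n.
  rewrite mul1r subrr ComplexField.Normc.normc0 mulr0.
  by rewrite !mulr_ge0 ?expR_ge0 ?normc_ge0.
rewrite mul0r subr0 mulrA -expRD ler_wpM2r ?normc_ge0// ler_expR addrC.
exact: ckm.
Qed.

Lemma coordinate_continuous n : continuous (coordinate n).
Proof.
move=> x A /nbhs_ballP[e /= e0 eA].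
(* A positive element of [R[i]] is real, hence equal to its modulus. *)
have eE : e = (normc e)%:C%C by rewrite -normc_real gtr0_norm.
have ne0 : 0 < normc e by rewrite -ltcR -eE.
apply/weighted_nbhsE; exists 0%N, (expR (c 0 n) * normc e).
  by rewrite mulr_gt0 ?expR_gt0.
move=> y xy; apply: eA; rewrite /ball /= eE distrC normc_real ltcR.
have := le_lt_trans (normc_coordinate_le 0 n (y - x)) (xy 0%N (leqnn _)).
by rewrite linearB /= ltr_pM2l ?expR_gt0.
Qed.

End WeightedSpace.

(** * Lower and upper bounds for widths *)

Lemma exists_annihilator (F : fieldType) (m n : nat) (v : 'I_n -> 'I_m -> F) :
  (n < m)%N -> exists2 phi : 'I_m -> F, exists j, phi j != 0 &
    forall i, \sum_(j < m) phi j * v i j = 0.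
Proof.
move=> nm; pose A : 'M[F]_(m, n) := \matrix_(j, i) v i j.
(* With [m] rows and only [n < m] columns, the rows of [A] are linearly dependent. *)
have : kermx A != 0.
  rewrite kermx_eq0; apply/negP => /eqP rA.
  by have := rank_leq_col A; rewrite rA leqNgt nm.
rewrite -nz_row_eq0 => /rV0Pn[j phij].
exists (fun j => nz_row (kermx A) 0 j); first by exists j.
move=> i; have /sub_kermxP/matrixP/(_ 0 i) := nz_row_sub (kermx A).
rewrite mxE [X in _ = X]mxE => sum0; rewrite -[RHS]sum0.
by apply: eq_bigr => l _; rewrite [A _ _]mxE.
Qed.

Lemma normc_sum_le (R : realType) (I : Type) (r : seq I) (f : I -> R[i]) :
  normc (\sum_(i <- r) f i) <= \sum_(i <- r) normc (f i).
Proof.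
elim/big_ind2: _ => [|x a y b xa yb|//].
  by rewrite ComplexField.Normc.normc0.
by rewrite (le_trans (le_normcD _ _))// lerD.
Qed.

Section WidthBounds.
Context {R : realType}.

(* A nonzero combination [Phi] of the [n + 1] functionals [g j] vanishes on the
   given [n]-dimensional subspace.  The dual norm of [Phi] is attained at some
   [(w j)^-1 *: e j], so [e j] has distance at least [w j] to the subspace. *)
Lemma kolmogorov_width_ge {X : tvsType R[i]} (n : nat) (B U : set X)
    (g : 'I_n.+1 -> {linear X -> R[i]^o}) (e : 'I_n.+1 -> X)
    (w : 'I_n.+1 -> R) (v : R) :
  (forall j, B (e j)) -> (forall i j, g i (e j) = (i == j)%:R) ->
  (forall j, 0 < w j) -> (forall j, v <= w j) ->
  (forall u, U u -> \sum_j w j * normc (g j u) <= 1) ->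
  (v%:E <= kolmogorov_width n B U)%E.
Proof.
move=> Be ge w0 vw Uw; apply: le_ereal_inf_tmp => _ [d [d0 [L [b ->] BU]] <-].
rewrite lee_fin.
have [phi [i0 phi0] phib] :=
  exists_annihilator (fun i j => g j (b i)) (ltnSn n).
pose Phi x : R[i] := \sum_j phi j * g j x.
case: (@arg_maxP _ _ _ i0 xpredT (fun j => normc (phi j) / w j)) => // j _ jmax.
set r := normc (phi j) / w j in jmax.
have r0 : 0 < r.
  apply: lt_le_trans (jmax i0 isT); rewrite divr_gt0// lt_def normc_ge0 andbT.
  by apply: contra phi0 => /eqP/ComplexField.Normc.eq0_normc/eqP.
have [u Uu [_ [a ->] uj]] := BU _ (Be j).
have Phij : Phi (e j) = phi j.
  rewrite /Phi (bigD1 j)//= ge eqxx big1 => [|i /negbTE ij].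
    by rewrite addr0 mulr1.
  by rewrite ge ij mulr0.
have Phiu : Phi (e j) = (d%:C)%C * Phi u.
  rewrite -uj /Phi mulr_sumr.
  under eq_bigr do rewrite linearD linearZ /= linear_sum mulrDr.
  rewrite big_split /= [X in _ + X](_ : _ = 0) ?addr0; last first.
    under eq_bigr do rewrite mulr_sumr.
    rewrite exchange_big /= big1// => i _.
    transitivity (a i * \sum_j phi j * g j (b i)); last by rewrite phib mulr0.
    rewrite mulr_sumr; apply: eq_bigr => l _.
    by rewrite linearZ /= [LHS]mulrCA.
  by apply: eq_bigr => i _; rewrite [LHS]mulrCA.
have Phi_le : normc (Phi u) <= r.
  rewrite (le_trans (normc_sum_le _ _))//.
  apply: (@le_trans _ _ (\sum_j r * (w j * normc (g j u)))).
    apply: ler_sum => i _; rewrite ComplexField.Normc.normcM mulrA.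
    by rewrite ler_wpM2r ?normc_ge0// -ler_pdivrMr//; exact: jmax.
  by rewrite -mulr_sumr ler_piMr ?(ltW r0)// Uw.
(* It remains to cancel [r] in w_j r = |phi_j| = d |Phi u| <= d r. *)
apply: le_trans (vw j) _.
have : normc (phi j) <= d * r.
  rewrite -Phij Phiu ComplexField.Normc.normcM normc_real_ge0 ?(ltW d0)//.
  by rewrite ler_pM2l.
have -> : normc (phi j) = w j * r by rewrite mulrC divfK// gt_eqF.
by rewrite ler_pM2r.
Qed.

(** Truncating both components gives an approximant in the span of [n + n'] unit vectors, and the
    two errors are tails. *)
Lemma kolmogorov_width_prod_le (c0 c1 : nat -> nat -> R) (k m n n' : nat)
    (t e : R) (U V : set (weighted_l1 c0 * weighted_l1 c1)%type) :
  0 < e ->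
  (forall j, (n <= j)%N -> c0 k j <= c0 m j - t) ->
  (forall j, (n' <= j)%N -> c1 k j <= c1 m j - t) ->
  [set z | weighted_seminorm k z.1 + weighted_seminorm k z.2 < e] `<=` U ->
  V `<=` [set z | weighted_seminorm m z.1 + weighted_seminorm m z.2 < 1] ->
  (kolmogorov_width (n + n') V U <= (expR (- t) / e)%:E)%E.
Proof.
move=> e0 ckm0 ckm1 kU Vm.
pose b (i : 'I_(n + n')) : (weighted_l1 c0 * weighted_l1 c1)%type :=
  match fintype.split i with
  | inl j => (unit_seq c0 j, 0)
  | inr j => (0, unit_seq c1 j)
  end.
have d0 : 0 < expR (- t) / e by rewrite divr_gt0 ?expR_gt0.
apply: (kolmogorov_width_le (b := b)) => // -[x y] /Vm /= xy1.
pose a (i : 'I_(n + n')) : R[i] := match fintype.split i with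
  | inl j => coordinate j x | inr j => coordinate j y end.
exists a; apply: kU => /=.
have -> : \sum_i a i *: b i = (head n x, head n' y).
  rewrite big_split_ord /=.
  have -> : \sum_(i < n) a (lshift n' i) *: b (lshift n' i) = (head n x, 0).
    rewrite [LHS]surjective_pairing; congr pair.
      rewrite (linear_sum fst) /=; apply: eq_bigr => i _.
      by rewrite /a /b (unsplitK (inl i)).
    rewrite (linear_sum snd) /= big1// => i _.
    by rewrite /a /b (unsplitK (inl i)) /= scaler0.
  have -> : \sum_(i < n') a (rshift n i) *: b (rshift n i) = (0, head n' y).
    rewrite [LHS]surjective_pairing; congr pair.
      rewrite (linear_sum fst) /= big1// => i _.
      by rewrite /a /b (unsplitK (inr i)) /= scaler0.
    rewrite (linear_sum snd) /=; apply: eq_bigr => i _.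
    by rewrite /a /b (unsplitK (inr i)).
  by congr pair; rewrite ?addr0 ?add0r.
rewrite !(seminormZ_real (weighted_seminormP _ _)) ?invr_ge0 ?(ltW d0)//=.
rewrite -mulrDr ltr_pdivrMl// divfK ?gt_eqF//.
have /le_lt_trans := lerD (weighted_seminorm_tail x ckm0)
  (weighted_seminorm_tail y ckm1); apply.
by rewrite -mulrDr gtr_pMr ?expR_gt0.
Qed.

End WidthBounds.

(** * The product of power series spaces: widths and a prominent set *)

Section PowerSeriesProduct.
Context {R : realType} (alpha : nat -> R).
Hypothesis alpha_incr : nondecreasing_seq alpha.
Hypothesis alpha_gt0 : forall n, 0 < alpha n.

Let X : tvsType R[i] := (Lambda0 alpha * Lambda_infty alpha)%type.

(** For [n > 1] one has n <= 4 (n./2), so two doublings, each costing a factor from stability,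
    suffice. *)
Lemma stable_half : stable alpha ->
  exists2 M : R, 0 < M & forall n, (1 < n)%N -> alpha n <= M * alpha n./2.
Proof.
(* [M0P] bounds the quotients only by numbers strictly above [M0], hence [M0 + 1]; the maximum with
   1 ensures positivity. *)
move=> [M0 [_ M0P]]; pose M := Num.max 1 (M0 + 1).
have M_gt0 : 0 < M by rewrite lt_max ltr01.
have dbl n : alpha n.*2 <= M * alpha n.
  rewrite -ler_pdivrMr//; apply: le_trans (ler_norm _) _.
  by apply: (M0P M) => //; rewrite lt_max ltrDl ltr01 orbT.
exists (M * M) => [|n n1]; first exact: mulr_gt0.
apply: (@le_trans _ _ (alpha n./2.*2.*2)).
  apply: alpha_incr; rewrite -[leqLHS]odd_double_half -[leqRHS]addnn leq_add2r.
  by rewrite (leq_trans (leq_b1 _))// double_gt0 half_gt0.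
by rewrite (le_trans (dbl _))// -mulrA ler_pM2l.
Qed.

Definition unit_set : set X := range (fun n => (unit_seq _ n, 0)).

(** As [alpha] is positive, all weights of [Lambda0] are at most 1. *)
Lemma unit_set_bounded : tvs_bounded unit_set.
Proof.
have fund := Lambda_prod_fundamental alpha_gt0.
apply: (fundamental_tvs_bounded (M := fun=> 1) fund).
move=> k _ [n _ <-]; rewrite /Lambda_prod_seminorm /=.
rewrite weighted_seminorm_unit_seq weighted_seminorm0 addr0 -expR0 ler_expR.
by rewrite mulNr oppr_le0 divr_ge0// ltW.
Qed.

(** The weights decrease with the index, so among the first [n + 1] unit vectors the last one has
    the smallest seminorm, which bounds the width from below. *)
Lemma unit_set_width_ge k n :
  ((expR (- alpha n / k.+1%:R))%:E <= kolmogorov_width n unit_set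
     [set z | Lambda_prod_seminorm k z < 1]%R)%E.
Proof.
apply: (kolmogorov_width_ge (X := X)
  (g := fun j => (coordinate j \o fst : {linear X -> R[i]^o}))
  (e := fun j => (unit_seq _ j, 0)) (w := fun j => expR (- alpha j / k.+1%:R))).
- by move=> j; exists (j : nat).
- by move=> i j.
- by move=> j; exact: expR_gt0.
- move=> j; rewrite ler_expR !mulNr lerN2 ler_wpM2r ?invr_ge0// alpha_incr//.
  by rewrite -ltnS.
- move=> u /ltW; apply: le_trans; rewrite /Lambda_prod_seminorm.
  apply: le_trans (weighted_partial_sum_le k n.+1 u.1) _.
  by rewrite lerDl weighted_seminorm_ge0.
Qed.

(** The dimension [n] is split into [n./2] for [Lambda0] and [uphalf n] for [Lambda_infty]; both
    tails gain at least [alpha n./2 / k.*2.+2%:R] in the exponent when [k] is replaced by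
    [k.*2.+1]. *)
Lemma Lambda_prod_width_le k n (e : R) (U : set X) : 0 < e ->
  [set z | Lambda_prod_seminorm k z < e] `<=` U ->
  (kolmogorov_width n [set z | Lambda_prod_seminorm k.*2.+1 z < 1]%R U <=
     (e^-1)%:E * (expR (- (alpha n./2 / k.*2.+2%:R)))%:E)%E.
Proof.
move=> e0 kU; rewrite -EFinM mulrC -{1}[n]odd_double_half.
have -> : (odd n + n./2.*2 = n./2 + uphalf n)%N.
  by rewrite uphalf_half addnCA addnn.
apply: (kolmogorov_width_prod_le (k := k) (m := k.*2.+1)) e0 _ _ kU _ => // j.
  move=> nj.
  (* Index 2k + 1 of [Lambda0] has divisor 2k + 2, so exactly half of alpha_j / (k + 1) is
     gained. *)
  have kE : k.+1%:R^-1 = k.*2.+2%:R^-1 + k.*2.+2%:R^-1 :> R.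
    by rewrite -doubleS -[k.+1.*2]muln2 natrM invfM -splitr.
  rewrite kE mulrDr !mulNr lerD2l lerN2 ler_wpM2r ?invr_ge0//.
  exact: alpha_incr.
move=> nj; have aj : alpha n./2 <= alpha j.
  by apply: alpha_incr; apply: leq_trans nj; rewrite uphalf_half leq_addl.
rewrite lerBrDr.
(* Here the gain is (k + 1) alpha_j, more than enough. *)
have -> : k.*2.+1%:R * alpha j = k%:R * alpha j + k.+1%:R * alpha j.
  by rewrite -mulrDl -natrD addnS addnn.
rewrite lerD2l.
have le1 : alpha n./2 / k.*2.+2%:R <= alpha n./2.
  by rewrite ler_pdivrMr// ler_peMr ?(ltW (alpha_gt0 _))// ler1n.
rewrite (le_trans le1)// (le_trans aj)// ler_peMl ?(ltW (alpha_gt0 _))//.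
by rewrite ler1n.
Qed.

Lemma unit_set_prominent : stable alpha -> prominent unit_set.
Proof.
move=> alpha_stable; split; first exact: unit_set_bounded.
apply/seteqP; split=> xi /= xiP.
  move=> U U0; exact: diametral_dimension_bounded unit_set_bounded xiP U0.
have fund := Lambda_prod_fundamental alpha_gt0.
(* Testing [xi] on the unit balls turns the lower width bound into decay against every weight of
   [Lambda0]. *)
have xi_cvg k :
    ((xi n)%:E * (expR (- alpha n / k.+1%:R))%:E)%E @[n --> \oo] --> 0%E.
  have := xiP _ (fundamental_zero_nbhds k fund ltr01).
  apply: (mule_cvg0_dominated ler01); apply: nearW => n.
  by rewrite lee_fin expR_ge0 mul1e unit_set_width_ge.
move=> U [/(let: And3 _ _ nP := fund in nP)[k [e e0 kU]] _].
exists [set z | Lambda_prod_seminorm k.*2.+1 z < 1].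
  exact: fundamental_zero_nbhds.
have [M M0 alphaM] := stable_half alpha_stable.
(* Since M (2k + 2) <= l + 1, stability yields alpha_n / (l + 1) <= alpha_(n./2) / (2k + 2) for
   [n > 1]. *)
pose l := Num.bound (M * k.*2.+2%:R).
have e'0 : 0 <= e^-1 by rewrite invr_ge0 ltW.
apply: (mule_cvg0_dominated e'0) (xi_cvg l).
exists 2%N => // n /= n2.
rewrite kolmogorov_width_ge0 (le_trans (Lambda_prod_width_le _ e0 kU))//.
rewrite lee_wpmul2l ?lee_fin// ler_expR mulNr lerN2.
rewrite ler_pdivrMr// mulrAC ler_pdivlMr//.
have lM : M * k.*2.+2%:R <= l.+1%:R.
  apply/ltW/(lt_le_trans (archi_boundP _)); first by rewrite mulr_ge0// ltW.
  by rewrite ler_nat.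
rewrite (le_trans (ler_wpM2r _ (alphaM n n2)))// [M * _]mulrC -mulrA.
by rewrite ler_pM2l.
Qed.

(** * Failure of (Omega bar) for the product *)

Lemma not_Omega_bar : alpha n @[n --> \oo] --> +oo -> ~ Omega_bar X.
Proof.
move=> alpha_cvg [p pfund pOmega].
have qfund := Lambda_prod_fundamental alpha_gt0.
(* The levels [k], [l], [m0] of [p] are compared with the explicit levels 0, [a], 2a + 1; the last
   exceeds twice the middle one by 1, which leaves one factor exp (alpha_n) to be bounded. *)
have [k [C0 C00 kC0]] := fundamental_compare 0 qfund pfund.
have [l kl lOmega] := pOmega k.
have [a [C1 C10 lC1]] := fundamental_compare l pfund qfund.
have [m0 [C2 C20 mC2]] := fundamental_compare a.*2.+1 qfund pfund.
have [C C_gt0 COmega] := lOmega (maxn l m0) (leq_maxl _ _).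
pose K := C * C0 * C2 * C1 ^+ 2.
suff alpha_le n : expR (alpha n) <= K.
  (* Some alpha_N is at least [K], while 1 + alpha_N <= exp (alpha_N) <= K. *)
  move/cvgryPge: alpha_cvg => /(_ K)[N _ /(_ N (leqnn N)) KN].
  have := le_trans (expR_ge1Dx _) (alpha_le N).
  by rewrite leNgt (le_lt_trans KN)// ltrDr.
pose phi : {linear X -> R[i]^o} := coordinate n \o snd.
have phi_cont : continuous phi.
  move=> z; apply: (@continuous_comp _ _ _ snd); first exact: cvg_snd.
  exact: coordinate_continuous.
have phi_le j z :
    normc (phi z) <= expR (- (j%:R * alpha n)) * Lambda_prod_seminorm j z.
  rewrite expRN -ler_pdivrMl ?invr_gt0 ?expR_gt0// invrK.
  apply: le_trans (normc_coordinate_le j n z.2) _.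
  by rewrite lerDr weighted_seminorm_ge0.
have dual_ge0 j : (0 <= dual_norm (p j) phi)%E.
  have [pP _ _] := pfund.
  have p0 : p j 0 <= 1 by rewrite (seminorm0 (pP j)).
  by apply: le_trans _ (dual_norm_ge phi p0); rewrite lee_fin normc_ge0.
have dual_k : (dual_norm (p k) phi <= C0%:E)%E.
  apply: dual_norm_le => z /kC0; apply: le_trans.
  by apply: le_trans (phi_le 0%N z) _; rewrite mul0r oppr0 expR0 mul1r.
have dual_m : (dual_norm (p (maxn l m0)) phi <=
    (expR (- (a.*2.+1%:R * alpha n)) * C2)%:E)%E.
  apply: dual_norm_le => z zm; apply: le_trans (phi_le a.*2.+1 z) _.
  rewrite ler_pM2l ?expR_gt0// mC2// (le_trans _ zm)//.
  by apply: fundamental_le => //; exact: leq_maxr.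
have dual_l : ((C1^-1 * expR (- (a%:R * alpha n)))%:E <= dual_norm (p l) phi)%E.
  have [pP _ _] := pfund; have [qP _ _] := qfund.
  set E := expR _; have E0 : 0 <= E by exact: expR_ge0.
  have C1i : 0 <= C1^-1 by rewrite invr_ge0 ltW.
  (* The unit vector is normalized to explicit seminorm 1 at level [a], then divided by [C1] to
     enter the unit ball of [p l]. *)
  pose z : X := (C1^-1)%:C%C *: (E%:C%C *: (0, unit_seq _ n)).
  have phiz : phi z = (C1^-1 * E)%:C%C.
    transitivity ((C1^-1)%:C%C * (E%:C%C * (n == n)%:R)) => //.
    by rewrite eqxx mulr1 rmorphM.
  rewrite -[_ * _](@normc_real_ge0 R) ?mulr_ge0// -phiz; apply: dual_norm_ge.
  rewrite (seminormZ_real (pP l))// ler_pdivrMl// mulr1; apply: lC1.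
  rewrite (seminormZ_real (qP a))// /Lambda_prod_seminorm /=.
  rewrite weighted_seminorm0 weighted_seminorm_unit_seq add0r -expRD addNr.
  by rewrite expR0.
have /(_ phi phi_cont) Omega_phi := COmega.
have : ((C1^-1 * expR (- (a%:R * alpha n)))%:E ^+ 2 <=
    C%:E * C0%:E * (expR (- (a.*2.+1%:R * alpha n)) * C2)%:E)%E.
  rewrite expe2; apply: (@le_trans _ _ (dual_norm (p l) phi ^+ 2)%E).
    rewrite expe2; apply: lee_pmul => //; rewrite lee_fin mulr_ge0 ?expR_ge0//.
      by rewrite invr_ge0 ltW.
    by rewrite invr_ge0 ltW.
  apply: le_trans Omega_phi _; apply: lee_pmul => //.
    by rewrite mule_ge0// lee_fin ltW.
  by rewrite lee_wpmul2l// lee_fin ltW.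
rewrite expe2 -!EFinM lee_fin => le_exp.
have E0 := expR_gt0 (a%:R * alpha n); have e0 := expR_gt0 (alpha n).
move: le_exp; rewrite -addnn -addnS natrD mulrDl -natr1 mulrDl mul1r.
rewrite !expRN !expRD.
set E := expR (a%:R * alpha n); set e := expR (alpha n) => le_exp.
(* Multiplying by this factor clears the denominators and leaves exp (alpha_n) <= K. *)
have F0 : 0 < (E * (E * e)) * C1 ^+ 2 by rewrite !mulr_gt0 ?exprn_gt0.
move: le_exp; rewrite -(ler_pM2l F0); congr (_ <= _).
  by field; rewrite !gt_eqF.
by rewrite /K; field; rewrite !gt_eqF.
Qed.

End PowerSeriesProduct.

Theorem proposition2p3 (R : realType) (alpha : nat -> R)
    (alpha_incr : nondecreasing_seq alpha)
    (alpha_gt0 : forall n, 0 < alpha n)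
    (alpha_cvg : alpha n @[n --> \oo] --> +oo)
    (alpha_stable : stable alpha) :
  let X : tvsType R[i] := (Lambda0 alpha * Lambda_infty alpha)%type in
  (exists B : set X, prominent B) /\ ~ Omega_bar X.
Proof.
split; last exact: not_Omega_bar.
exists (@unit_set R alpha); exact: unit_set_prominent.
Qed.
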